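(* Let $W(1),\dots,W(T)\in\mathbb R^{n\times n}$ be a sequence of observed networks over timesteps $t\in[T]$, and assume that: (a) $\Gamma(t)=I$ and $\Sigma_i(t)=\Sigma$ for all $t\in[T]$ (and all agents $i\in[n]$); (b) for all $i,j\in[n]$, $M_{ij}(t)$ varies independently according to a Brownian motion with the same parameters for all $(i,j)$; (c) $\mathrm{tr}(\Sigma)=1$. Then finding the maximum likelihood estimator of $\Sigma$ under these assumptions is equivalent to the following semidefinite program: $$\min_{\Sigma}\ \sum_{t=1}^{T-1}\big\|\Sigma\,(W(t+1)-W(t))+(W(t+1)-W(t))\,\Sigma\big\|_F^2\quad\text{s.t. }\ \Sigma\succeq0,\ \mathrm{tr}(\Sigma)=1.$$
   Context: $[r]=\{1,\dots,r\}$; $\mathbf e_1,\dots,\mathbf e_n$ is the standard basis of $\mathbb R^n$; $\|\cdot\|_F$ is the Frobenius norm; $A\succeq0$ ($A\succ 0$) means $A$ is positive semidefinite (positive definite). There are $n$ agents. At time $t$, agent $i$ has a vector $\boldsymbol\mu_i(t)\in\mathbb R^n$ of expected returns (the $i$-th column of $M(t)\in\mathbb R^{n\times n}$), a covariance matrix $\Sigma_i(t)\succ0$, and a risk aversion $\gamma_i(t)>0$; $\Gamma(t)=\mathrm{diag}(\gamma_1(t),\dots,\gamma_n(t))$. All edges (contracts between any two agents, and self-investments) are allowed. A pair $(W,P)$ of real $n\times n$ matrices is feasible if $W=W^T$ and $P=-P^T$. With $\mathbf w_i$ the $i$-th column of $W$, agent $i$'s utility is $g_i(W,P)=\mathbf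 w_i^T(\boldsymbol\mu_i-P\mathbf e_i)-\gamma_i\,\mathbf w_i^T\Sigma_i\mathbf w_i$. A feasible $(W,P)$ is a stable point if for every $i\in[n]$, $g_i(W,P)$ equals the maximum of $g_i(W',P)$ over feasible $(W',P)$. Each $W(t)$ is the network at the unique stable point for the beliefs at time $t$; when $\Gamma(t)=I$ and $\Sigma_i(t)=\Sigma$ for all $i$, it satisfies $\Sigma W(t)+W(t)\Sigma=\frac12(M(t)+M(t)^T)$. The networks $W(t)$ are observed; $\Sigma\succ0$ and the $M(t)$ are not. Brownian motion with scale parameter $\sigma>0$ (the same for all entries) means: the entries $M_{ij}(\cdot)$ are independent processes, each with independent increments, with increments $M_{ij}(t+r)-M_{ij}(t)\sim N(0,r\sigma^2)$ for $r>0$, and with sample paths continuous with probability $1$.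
   Formalization: The likelihood is the density of the unobserved increments of (M+M^T)/2 implied by Σ and the observed W(t), not the density of the W(t) themselves; the latter has an extra Σ-dependent Jacobian, with which the claim fails (n=2, T=2, W(2)-W(1)=diag(1,-1)). *)

(* Defs.v *)
From HB Require Import structures.
From mathcomp Require Import all_boot all_order all_algebra.
From mathcomp Require Import all_classical all_reals all_analysis.

Set Implicit Arguments.
Unset Strict Implicit.
Unset Printing Implicit Defensive.

Import Order.TTheory GRing.Theory Num.Theory.
Import numFieldNormedType.Exports.

Local Open Scope classical_set_scope.
Local Open Scope ring_scope.

Section Matrices.
Context {R : realType} {n : nat}.
Implicit Types A : 'M[R]_n.

Definition psd A : Prop :=
  A^T = A /\ forall x : 'cV[R]_n, 0 <= (x^T *m A *m x) 0 0.

Definition posdef A : Prop :=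
  A^T = A /\ forall x : 'cV[R]_n, x != 0 -> 0 < (x^T *m A *m x) 0 0.

Definition frobenius_norm A : R := Num.sqrt (\sum_i \sum_j A i j ^+ 2).

Definition symmetric_part A : 'M[R]_n := 2^-1 *: (A + A^T).

End Matrices.

Section Networks.
Context {R : realType} {n : nat}.
Implicit Types (M W P : 'M[R]_n) (gamma : 'I_n -> R) (Sig : 'I_n -> 'M[R]_n).

Definition feasible W P : Prop := W = W^T /\ P = - P^T.

Definition utility gamma Sig M W P (i : 'I_n) : R :=
  let w := col i W in
  (w^T *m (col i M - P *m delta_mx i 0)) 0 0
    - gamma i * (w^T *m Sig i *m w) 0 0.

Definition stable_point gamma Sig M W P : Prop :=
  feasible W P /\
  forall i W', feasible W' P ->
    utility gamma Sig M W' P i <= utility gamma Sig M W P i.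

(* The case Gamma = I and Sigma_i = Sigma for every agent i. *)
Definition homogeneous_network (Sigma M W : 'M[R]_n) : Prop :=
  exists P, stable_point (fun=> 1) (fun=> Sigma) M W P.

End Networks.

Section Processes.
Context {R : realType} {d : measure_display} {Omega : measurableType d}.
Variable P : probability Omega R.

Definition process_sigma_algebra (X : R -> Omega -> R) : set (set Omega) :=
  <<s [set E | exists t B, [/\ 0 <= t, measurable B & E = X t @^-1` B]] >>.

(* No subfamily is needed on the right: any A i may be taken to be setT. *)
Definition independent_processes (I : finType) (X : I -> R -> Omega -> R) :=
  forall A : I -> set Omega,
    (forall i, process_sigma_algebra (X i) (A i)) ->
    P (\bigcap_i A i) = (\prod_i P (A i))%E.

Definition independent_increments (X : R -> Omega -> R) : Prop :=
  forall (m : nat) (s : nat -> R) (B : 'I_m -> set R),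
    0 <= s 0%N -> (forall k, s k <= s k.+1) -> (forall k, measurable (B k)) ->
    let E k := [set w | B k (X (s k.+1) w - X (s k) w)] in
    P (\bigcap_k E k) = (\prod_k P (E k))%E.

(* The distribution at time 0 is left unspecified. *)
Record brownian_motion (sigma : R) (X : R -> Omega -> R) : Prop := {
  bm_measurable : forall t, 0 <= t -> measurable_fun setT (X t);
  bm_independent : independent_increments X;
  (* [normal_prob] takes the standard deviation, here that of N(0, r sigma^2) *)
  bm_gaussian : forall t r, 0 <= t -> 0 < r ->
    forall B : set R, measurable B ->
      P [set w | B (X (t + r) w - X t w)]
        = normal_prob 0 (sigma * Num.sqrt r) B;
  bm_continuous :
    {ae P, forall w, {within `[0, +oo[, continuous (fun t => X t w)}} }.

Definition brownian_matrix (n : nat) (sigma : R) (M : R -> Omega -> 'M[R]_n) :=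
  (forall i j, brownian_motion sigma (fun t w => M t w i j)) /\
  independent_processes
    (fun ij : 'I_n * 'I_n => fun t w => M t w ij.1 ij.2).

(* Integral of f over the box B_0 x ... x B_(N-1) for the N-dimensional Lebesgue
   measure, as an iterated integral. *)
Fixpoint box_integral (N : nat) :
    ('I_N -> set R) -> ('rV[R]_N -> R) -> \bar R :=
  match N with
  | 0 => fun _ f => (f 0)%:E
  | N'.+1 => fun B f =>
      (\int[lebesgue_measure]_(x in B ord0)
         box_integral (fun k => B (lift ord0 k))
           (fun v : 'rV[R]_N' => f (row_mx (x%:M : 'rV[R]_1) v)))%E
  end.

(* Continuity selects a unique version of the density, so that its values at
   points are meaningful. *)
Definition continuous_density (N : nat) (X : Omega -> 'rV[R]_N)
    (p : 'rV[R]_N -> R) : Prop :=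
  [/\ continuous p, (forall v, 0 <= p v) &
      forall B : 'I_N -> set R, (forall k, measurable (B k)) ->
        P [set w | forall k, B k (X w 0 k)] = box_integral B p].

End Processes.

Section Likelihood.
Context {R : realType} {n : nat}.
Variable T : nat.

(* A step of the time axis 1, ..., T together with an entry on or above the
   diagonal; the step k goes from time k+1 to time k+2. *)
Definition increment_index : finType :=
  ('I_T.-1 * {ij : 'I_n * 'I_n | (ij.1 <= ij.2)%N})%type.

(* The increments of the symmetric part of N, as a vector of their free
   entries: the upper triangular ones. *)
Definition symmetric_increments (N : nat -> 'M[R]_n) :
    'rV[R]_#|increment_index| :=
  \row_(a < #|increment_index|)
    let: (k, ij) := enum_val a : 'I_T.-1 * {ij : 'I_n * 'I_n | _} in
    (symmetric_part (N k.+2) - symmetric_part (N k.+1)) (val ij).1 (val ij).2.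

(* Given Sigma, the networks W determine the symmetric part of the beliefs N
   behind them (and not N itself), so l is unique.  With p the density of the
   increments of that symmetric part, the likelihood of Sigma is the density of
   the increments implied by Sigma and W.  It is a density with respect to
   Lebesgue measure on the belief increments, whatever Sigma is; a density of W
   itself would carry in addition the Jacobian of S |-> Sigma S + S Sigma on
   symmetric matrices. *)
Definition likelihood (p : 'rV[R]_#|increment_index| -> R)
    (W : nat -> 'M[R]_n) (Sigma : 'M[R]_n) (l : R) : Prop :=
  exists N : nat -> 'M[R]_n,
    (forall t, (1 <= t <= T)%N -> homogeneous_network Sigma (N t) (W t)) /\
    l = p (symmetric_increments N).

Definition maximum_likelihood_estimator (Theta : set 'M[R]_n)
    (p : 'rV[R]_#|increment_index| -> R) (W : nat -> 'M[R]_n)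
    (Sigma : 'M[R]_n) : Prop :=
  Theta Sigma /\
  exists l, likelihood p W Sigma l /\
    forall Sigma' l', Theta Sigma' -> likelihood p W Sigma' l' -> l' <= l.

Definition sdp_objective (W : nat -> 'M[R]_n) (Sigma : 'M[R]_n) : R :=
  \sum_(1 <= t < T)
    frobenius_norm (Sigma *m (W t.+1 - W t) + (W t.+1 - W t) *m Sigma) ^+ 2.

Definition sdp_feasible (Sigma : 'M[R]_n) : Prop := psd Sigma /\ \tr Sigma = 1.

Definition sdp_solution (W : nat -> 'M[R]_n) (Sigma : 'M[R]_n) : Prop :=
  sdp_feasible Sigma /\
  forall Sigma', sdp_feasible Sigma' ->
    sdp_objective W Sigma <= sdp_objective W Sigma'.

End Likelihood.

(* Main.v *)
(* The first-order condition of a stable point is M - P = 2 Sigma W; since P is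
   antisymmetric, the symmetric part of M is Sigma W + W Sigma, whatever P is.
   Increments of the symmetric part of a Brownian matrix are independent
   Gaussian, of variance sigma^2 on the diagonal and sigma^2 / 2 above it, so
   their density at D_1, ..., D_(T-1) is C exp (- sum_t |D_t|_F^2 / (2 sigma^2)):
   the factor 2 in the off-diagonal precision accounts for the two occurrences
   of each off-diagonal entry in the Frobenius norm.  Maximizing the likelihood
   is thus minimizing the objective.  Over positive definite matrices the
   infimum is the same as over positive semidefinite ones, by convexity: the
   midpoint of a positive definite minimizer and any feasible matrix is positive
   definite. *)

Require Import Defs.
From HB Require Import structures.
From mathcomp Require Import all_boot all_order all_algebra.
From mathcomp Require Import all_classical all_reals all_analysis.
From mathcomp Require Import measurable_realfun ring lra.

Set Implicit Arguments.
Unset Strict Implicit.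
Unset Printing Implicit Defensive.

Import Order.TTheory GRing.Theory Num.Theory.
Import numFieldNormedType.Exports.

Local Open Scope classical_set_scope.
Local Open Scope ring_scope.

(** * Stable points *)

Section Stability.
Context {R : realType} {n : nat}.
Implicit Types (A M N W P S : 'M[R]_n) (x y : 'cV[R]_n).

Lemma posdef_psd A : posdef A -> psd A.
Proof.
move=> [sA pA]; split=> // x; have [->|x0] := eqVneq x 0.
  by rewrite mulmx0 mxE.
exact/ltW/pA.
Qed.

Lemma bilinear_sym A x y : A^T = A ->
  (x^T *m A *m y) 0 0 = (y^T *m A *m x) 0 0.
Proof.
move=> sA; rewrite -[in LHS](trmxK (x^T *m A *m y)) mxE.
by rewrite !trmx_mul trmxK sA mulmxA.
Qed.

(** Near [0] a nonzero linear term dominates a quadratic one. This is the first-order condition at a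
    maximum, obtained without derivatives. *)
Lemma linear_le_quadratic_eq0 (b c : R) :
  (forall e, e * b <= e ^+ 2 * c) -> b = 0.
Proof.
move=> h; apply/eqP/negPn/negP => b0.
have [c0|c0] := leP c 0.
  have := h b; have : 0 < b ^+ 2 by rewrite exprn_even_gt0.
  have : b ^+ 2 * c <= 0 by rewrite mulr_ge0_le0 ?sqr_ge0.
  by rewrite expr2; lra.
(* The test point maximizes [e * b - e ^+ 2 * c], where the value is [b ^+ 2 / (4 * c)], positive
   for [b != 0]. *)
have := h (b / (2 * c)); have -> : b / (2 * c) * b = b ^+ 2 / (2 * c).
  by rewrite mulrAC expr2.
have -> : (b / (2 * c)) ^+ 2 * c = b ^+ 2 / (2 * c) / 2.
  by field; rewrite gt_eqF.
have : 0 < b ^+ 2 / (2 * c).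
  by rewrite divr_gt0 ?exprn_even_gt0 ?mulr_gt0.
lra.
Qed.

(** The utility is quadratic in [W], so this expansion is exact. The linear term yields the
    first-order condition, and the sign of the last term its sufficiency. *)
Lemma utilityD S M W E P i : S^T = S ->
  utility (fun=> 1) (fun=> S) M (W + E) P i =
  utility (fun=> 1) (fun=> S) M W P i
  + ((col i E)^T *m (col i (M - P - 2 *: (S *m W)))) 0 0
  - ((col i E)^T *m S *m col i E) 0 0.
Proof.
move=> sS; rewrite /utility /= !mul1r.
have -> : col i M - P *m delta_mx i 0 = col i (M - P) by rewrite -colE linearB.
rewrite (linearD (col i)) /= linearD /= !mulmxDl !mulmxDr.
have -> : col i (M - P - 2 *: (S *m W)) = col i (M - P) - 2 *: (S *m col i W).
  by rewrite linearB linearZ /= !colE mulmxA.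
have := bilinear_sym (col i W) (col i E) sS.
rewrite mulmxBr -scalemxAr !mulmxA !mxE => h.
rewrite h; ring.
Qed.

Lemma stable_pointP S M W P : S^T = S ->
  stable_point (fun=> 1) (fun=> S) M W P -> M - P = 2 *: (S *m W).
Proof.
move=> sS [[sW aP] opt]; apply/matrixP => j i; apply/eqP.
rewrite -subr_eq0; apply/eqP.
(* [E] is symmetric, so [W + e *: E] stays feasible, and its column [i] is the basis vector [j]:
   agent [i] can probe each coordinate of the gradient separately despite the symmetry
   constraint. *)
pose E : 'M[R]_n := \matrix_(a, b) ((a == i) && (b == j) || (a == j) && (b == i))%:R.
have coliE : col i E = delta_mx j 0.
  apply/matrixP => a b; rewrite !mxE ord1 eqxx !andbT.
  by case: (eqVneq a i) => [->|] //=; case: eqVneq; rewrite ?andbT ?orbF // => ->.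
have trE : E^T = E.
  by apply/matrixP => a b; rewrite !mxE orbC (andbC (b == i)) (andbC (b == j)).
apply: (@linear_le_quadratic_eq0 _ (S j j)) => e.
have trd : (e *: delta_mx j 0 : 'cV[R]_n)^T = e *: delta_mx 0 j.
  by rewrite linearZ /= trmx_delta.
have := opt i (W + e *: E); rewrite utilityD // linearZ /= coliE.
have -> : ((e *: delta_mx j 0 : 'cV[R]_n)^T *m col i (M - P - 2 *: (S *m W))) 0 0 =
    e * ((M - P) j i - (2 *: (S *m W)) j i) :> R.
  by rewrite trd -scalemxAl -rowE !mxE.
have -> : ((e *: delta_mx j 0 : 'cV[R]_n)^T *m S *m (e *: delta_mx j 0 : 'cV[R]_n)) 0 0 =
    e ^+ 2 * S j j :> R.
  rewrite trd -!scalemxAl -rowE -scalemxAr -colE.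
  by rewrite !mxE; ring.
rewrite -addrA gerDl subr_le0; apply; split=> //.
by rewrite linearD linearZ /= trE -sW.
Qed.

Lemma homogeneous_network_sym S M W : S^T = S ->
  homogeneous_network S M W -> symmetric_part M = S *m W + W *m S.
Proof.
move=> sS [P sP]; have := stable_pointP sS sP; case: sP => -[sW aP] _ MP.
have -> : M = 2 *: (S *m W) + P by rewrite -MP subrK.
have aP' : P^T = - P by rewrite [in RHS]aP opprK.
rewrite /symmetric_part.
have -> : (2 *: (S *m W) + P)^T = 2 *: (W *m S) - P.
  by rewrite [LHS]linearD linearZ /= trmx_mul sS -sW aP'.
by rewrite addrACA subrr addr0 -scalerDr scalerA mulVf ?scale1r ?pnatr_eq0.
Qed.

(** With [P = 0] the linear term of [utilityD] vanishes and semidefiniteness gives the sign of the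
    rest. Hence every candidate [S], even a singular one, has beliefs that explain [W]. *)
Lemma homogeneous_network_of_sym S W : psd S -> W = W^T ->
  homogeneous_network S (2 *: (S *m W)) W.
Proof.
move=> [sS pS] sW; exists 0; split; first by split=> //; rewrite trmx0 oppr0.
move=> i W' _; have -> : W' = W + (W' - W) by rewrite addrC subrK.
rewrite utilityD // subr0 subrr.
have -> : col i 0 = 0 :> 'cV[R]_n by apply/matrixP => a b; rewrite !mxE.
by rewrite mulmx0 mxE addr0 gerBl.
Qed.

End Stability.

(** * Densities on boxes *)

Section BoxIntegral.
Context {R : realType}.
Local Notation mu := (@lebesgue_measure R).

(* Unlike [ge0_le_integral], this needs no measurability: the partial integrals in
   [box_integral] of an arbitrary continuous function are not known to be
   measurable. *)
Lemma le_integral_nonneg (D : set R) (f g : R -> \bar R) :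
  (forall x, D x -> (0 <= f x)%E) -> (forall x, D x -> (f x <= g x)%E) ->
  (\int[mu]_(x in D) f x <= \int[mu]_(x in D) g x)%E.
Proof.
move=> f0 fg; have g0 x : D x -> (0 <= g x)%E.
  by move=> Dx; rewrite (le_trans (f0 x Dx))// fg.
rewrite !ge0_integralE//; apply: ub_ereal_sup => _ [h hf <-].
apply: ereal_sup_ubound; exists h => // x; rewrite (le_trans (hf x))//.
rewrite !patchE; case: ifPn => // /set_mem; exact: fg.
Qed.

Lemma box_integral_ge0 N (B : 'I_N -> set R) (f : 'rV[R]_N -> R) :
  (forall v, 0 <= f v) -> (0 <= box_integral B f)%E.
Proof.
elim: N B f => [|N IH] B f f0 /=; first by rewrite lee_fin.
by apply: integral_ge0 => x _; apply: IH.
Qed.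

Lemma row_mx_scalar_ord0 N (x : R) (v : 'rV[R]_N) :
  (row_mx (x%:M : 'rV_1) v : 'rV_N.+1) 0 ord0 = x.
Proof.
have -> : ord0 = lshift N (ord0 : 'I_1) by exact/val_inj.
by rewrite (row_mxEl (x%:M : 'rV_1)) mxE eqxx mulr1n.
Qed.

Lemma row_mx_scalar_lift N (x : R) (v : 'rV[R]_N) k :
  (row_mx (x%:M : 'rV_1) v : 'rV_N.+1) 0 (lift ord0 k) = v 0 k.
Proof.
have -> : lift ord0 k = rshift 1 k by exact/val_inj.
by rewrite (row_mxEr (x%:M : 'rV_1)).
Qed.

Lemma le_box_integral N (B : 'I_N -> set R) (f g : 'rV[R]_N -> R) :
  (forall v, 0 <= f v) ->
  (forall v : 'rV_N, (forall k, B k (v 0 k)) -> f v <= g v) ->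
  (box_integral B f <= box_integral B g)%E.
Proof.
elim: N B f g => [|N IH] B f g f0 fg /=; first by rewrite lee_fin fg// => -[].
apply: le_integral_nonneg => x Bx; first exact: box_integral_ge0.
apply: IH => // v Bv; apply: fg => k; case: (unliftP ord0 k) => [j ->|->].
  by rewrite row_mx_scalar_lift.
by rewrite row_mx_scalar_ord0.
Qed.

(** The constant [c] is there for the induction: at a fixed first coordinate [x] it absorbs the
    factor [q ord0 x]. *)
Lemma box_integral_prod N (B : 'I_N -> set R) (q : 'I_N -> R -> R) (c : R) :
  (forall k, measurable (B k)) ->
  (forall k, measurable_fun setT (q k)) -> (forall k x, 0 <= q k x) -> 0 <= c ->
  box_integral B (fun v => c * \prod_k q k (v 0 k)) =
  (c%:E * \prod_k \int[mu]_(x in B k) (q k x)%:E)%E.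
Proof.
elim: N B q c => [|N IH] B q c mB mq q0 c0 /=.
  by rewrite !big_ord0 mulr1 mule1.
under eq_integral => x _.
  rewrite (_ : (fun v => _) = (fun v => c * q ord0 x *
      \prod_k q (lift ord0 k) ((v : 'rV_N) 0 k))); last first.
    apply/funext => v; rewrite big_ord_recl -mulrA.
    rewrite row_mx_scalar_ord0; congr (_ * (_ * _)).
    by apply: eq_bigr => k _; rewrite row_mx_scalar_lift.
  rewrite (IH (fun k => B (lift ord0 k)) (fun k => q (lift ord0 k)) (c * q ord0 x))//.
    rewrite EFinM muleAC.
    over.
  by rewrite mulr_ge0.
rewrite big_ord_recl/=; set K := (\prod_(i < N) _)%E.
have K0 : (0 <= K)%E.
  by apply: prode_ge0 => i _; apply: integral_ge0 => x _; rewrite lee_fin.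
under eq_integral do rewrite muleC.
rewrite ge0_integralZr//; last 2 first.
- by move=> x _; rewrite lee_fin.
- exact: mule_ge0.
- by rewrite muleCA.
- exact: mB.
- by apply/measurable_EFinP/measurable_funTS; exact: mq.
Qed.

(** If [g v < f v], continuity separates the two functions by constants on a small box around [v],
    and so separates their integrals over that box. *)
Lemma le_continuous_box_integral N (f g : 'rV[R]_N -> R) :
  continuous f -> continuous g ->
  (forall v, 0 <= f v) -> (forall v, 0 <= g v) ->
  (forall B : 'I_N -> set R, (forall k, measurable (B k)) ->
     box_integral B f = box_integral B g) ->
  forall v, f v <= g v.
Proof.
move=> cf cg f0 g0 fg v; rewrite leNgt; apply/negP => gf.
(* Two thresholds [g v < c < c' < f v] leave a strict gap, although integrals are only compared
   weakly. *)
pose c := (f v + g v) / 2; pose c' := (f v + c) / 2.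
have c'f : c' < f v by rewrite /c' /c; lra.
have gc : g v < c by rewrite /c; lra.
have cc' : c < c' by rewrite /c' /c; lra.
have c0 : 0 < c by rewrite (le_lt_trans (g0 v)).
have : nbhs v [set w | c' < f w /\ g w < c].
  by apply: filterI; [exact: (cvgr_gt _ (cf v))|exact: (cvgr_lt _ (cg v))].
move=> /nbhs_ballP[e /= e0 ve].
(* Balls of row vectors are those of the sup norm, so this box lies inside the ball just found. *)
pose B k := `]v 0 k - e, v 0 k + e[%classic : set R.
have mB k : measurable (B k) by exact: measurable_itv.
have inB (w : 'rV_N) : (forall k, B k (w 0 k)) -> c' < f w /\ g w < c.
  move=> Bw; apply: ve; split=> // i j; rewrite !ord1.
  by have := Bw j; rewrite /B /= in_itv /= -ball_normE /= ltr_distlC.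
have box_cst a : 0 <= a ->
    box_integral B (fun=> a) = (a * (2 * e) ^+ N)%:E.
  move=> a0.
  rewrite [X in box_integral _ X](_ : _ = fun v : 'rV[R]_N => a * \prod_(k < N) cst 1 (v 0 k)).
    rewrite (@box_integral_prod _ B (fun=> cst 1) a)// EFinM; congr (_ * _)%E.
    rewrite (eq_bigr (fun=> (2 * e)%:E)); last first.
      move=> k _; rewrite [LHS](_ : _ = \int[mu]_(x in B k) cst 1%E x)%E//.
      rewrite integral_cst//=; last exact: mB.
      rewrite mul1e lebesgue_measure_itv /= lte_fin.
      by rewrite ltrD2l gtrN// -EFinD; congr EFin; ring.
    by rewrite (prodEFin _ _ (fun=> 2 * e)) prodr_const card_ord.
  by apply/funext => v'; rewrite big1 ?mulr1.
have : (box_integral B (fun=> c') <= box_integral B (fun=> c))%E.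
  apply: (@le_trans _ _ (box_integral B f)).
    by apply: le_box_integral => [_|w /inB[/ltW]//]; lra.
  by rewrite fg//; apply: le_box_integral => // w /inB[_ /ltW].
rewrite !box_cst ?(ltW c0) ?(ltW (lt_trans c0 cc'))//.
by rewrite lee_fin ler_pM2r ?exprn_gt0 ?mulr_gt0// leNgt cc'.
Qed.

End BoxIntegral.

(** * The average of two independent Gaussians *)

Section GaussianAverage.
Context {R : realType}.
Local Notation mu := (@lebesgue_measure R).
Local Open Scope ereal_scope.

(** The Radon-Nikodym derivative of [normal_prob] and [normal_pdf] have the same integral over every
    measurable set, hence agree almost everywhere. *)
Lemma integral_normal_prob (m s : R) (f : R -> \bar R) :
  (normal_prob m s).-integrable [set: measurableTypeR R] f ->
  \int[normal_prob m s]_x f x = \int[mu]_x (f x * (normal_pdf m s x)%:E).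
Proof.
move=> intf; have ac := normal_prob_dominates m s.
rewrite -(Radon_Nikodym_change_of_variables ac)//=.
have mf := measurable_int _ intf.
have mpdf : measurable_fun [set: measurableTypeR R] (fun x => (normal_pdf m s x)%:E).
  by apply/measurable_EFinP; exact: measurable_normal_pdf.
apply: ae_eq_integral => //.
- apply: (emeasurable_funM mf); apply: (measurable_int mu).
  by apply: Radon_Nikodym_integrable; exact: normal_prob_dominates.
- exact: emeasurable_funM mf mpdf.
- apply: ae_eqe_mul2l => /=.
  rewrite Radon_NikodymE//=.
  case: cid => /= h [h1 h2 h3].
  apply: integral_ae_eq => //.
  + by move=> E _ mE; rewrite -h3.
Qed.

(** Change of variables [y = 2 * u - x]: the averaging map pushes Lebesgue measure forward to twice
    itself. *)
Lemma integral_average (x : R) (f : R -> \bar R) :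
  measurable_fun setT f -> (forall u, 0 <= f u) ->
  \int[mu]_y f ((x + y) / 2)%R = 2%:E * \int[mu]_u f u.
Proof.
move=> mf f0; pose phi (y : measurableTypeR R) : measurableTypeR R := ((x + y) / 2)%R.
have mphi : measurable_fun setT phi.
  by apply: measurable_funM => //; exact: measurable_funD.
have H (A : set (measurableTypeR R)) : measurable A ->
    mu (phi @^-1` A) = 2%:E * mu A.
  (* Lebesgue measure is characterized by its values on intervals, so the factor is moved to the
     other side: half the pushforward, [nu], gives intervals their length. *)
  move=> mA; suff -> : mu A = (2^-1)%:E * mu (phi @^-1` A).
    by rewrite muleA -EFinM mulfV ?mul1e.
  have half_ge0 : (0 <= 2^-1 :> R)%R by [].
  pose nu : {measure set (measurableTypeR R) -> \bar R} :=
    mscale (NngNum half_ge0)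
      (measure_function_pushforward__canonical__measure_function_Measure mu mphi).
  transitivity (nu A); last by [].
  apply: lebesgue_measure_unique => //= _ [[a b]] /= _ <-; rewrite /nu.
  rewrite /mscale /= /pushforward.
  have -> : phi @^-1` `]a, b] = `](2 * a - x)%R, (2 * b - x)%R]%classic.
    apply/seteqP; split => y /=; rewrite !in_itv /= /phi; lra.
  rewrite !lebesgue_measure_itv /= !lte_fin ltrD2r ltr_pM2l//.
  case: ifP => _; last by rewrite mule0.
  by rewrite -!EFinD -EFinM; congr EFin; lra.
transitivity (\int[pushforward mu phi]_u f u).
  by rewrite ge0_integral_pushforward.
have -> : \int[pushforward mu phi]_u f u = \int[mscale (2%:nng)%R mu]_u f u.
  by apply: eq_measure_integral => A mA _; exact: H.
by rewrite ge0_integral_mscale.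
Qed.

Local Close Scope ereal_scope.

(* Completing the square: [x^2 + (2 u - x)^2 = 2 u^2 + 2 (x - u)^2]. *)
Lemma normal_pdfM_average (s x u : R) : s != 0 ->
  2 * (normal_pdf 0 s x * normal_pdf 0 s (2 * u - x)) =
   normal_pdf 0 (s / Num.sqrt 2) u * normal_pdf u (s / Num.sqrt 2) x.
Proof.
move=> s0; have s20 : Num.sqrt 2 != 0 :> R by rewrite gt_eqF ?sqrtr_gt0.
have q0 : (s / Num.sqrt 2 != 0)%R by rewrite mulf_neq0 ?invr_neq0.
have q2 : ((s / Num.sqrt 2) ^+ 2 = s ^+ 2 / 2)%R.
  by rewrite exprMn exprVn sqr_sqrtr.
rewrite !normal_pdfE// /normal_peak /normal_fun q2.
rewrite mulrACA [RHS]mulrACA -!expRD mulrA; congr (_ * expR _)%R; last by field.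
have p0 : (0 < s ^+ 2 * pi *+ 2)%R.
  by rewrite pmulrn_lgt0// mulr_gt0 ?pi_gt0// exprn_even_gt0.
have p1 : (0 < s ^+ 2 / 2 * pi *+ 2)%R.
  by rewrite pmulrn_lgt0// mulr_gt0 ?pi_gt0// divr_gt0// exprn_even_gt0.
rewrite -!invfM -!expr2 !sqr_sqrtr ?ltW//.
move: (pi_gt0 R); move: (@pi R) => c c0; field.
by rewrite s0 gt_eqF.
Qed.

(** In the coordinates [x] and [u = (x + y) / 2], [normal_pdfM_average] splits the joint density
    into the wanted density of [u] and a probability density in [x], which integrates to [1]. *)
Lemma normal_prob_average (s : R) (B : set R) : s != 0 -> measurable B ->
  (normal_prob 0 s \x normal_prob 0 s)%E [set z | B ((z.1 + z.2) / 2)%R] =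
  normal_prob 0 (s / Num.sqrt 2) B.
Proof.
move=> s0 mB; set D := [set z | _].
have mD : measurable D.
  have mavg : measurable_fun setT (fun z : R * R => (z.1 + z.2) / 2).
    by apply: measurable_funM => //; exact: measurable_funD.
  by rewrite -[D]setTI; exact: mavg.
rewrite /product_measure1 /=.
rewrite integral_normal_prob; last first.
  apply: (@le_integrable _ _ _ _ _ _ _ (cst 1%E)) => //.
  - exact: measurable_fun_xsection.
  - move=> x _ /=; rewrite gee0_abs ?measure_ge0// normr1.
    by apply: probability_le1; exact: measurable_xsection.
  - exact: finite_measure_integrable_cst.
(* The joint density in the coordinates [(x, u)], cut down to [u] in [B]; the factor [2] is the
   Jacobian of [y = 2 * u - x]. *)
pose g x u := \1_B u * (2 * (normal_pdf 0 s x * normal_pdf 0 s (2 * u - x))).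
have mB1 : measurable_fun setT (\1_B : R -> R) by [].
have mphi : measurable_fun setT (normal_pdf 0 s) := measurable_normal_pdf 0 s.
transitivity (\int[mu]_x \int[mu]_u (g x u)%:E)%E.
  apply: eq_integral => x _.
  pose F u := (\1_B u * normal_pdf 0 s (2 * u - x))%:E.
  have mF : measurable_fun setT F.
    apply/measurable_EFinP; apply: measurable_funM => //.
    apply: measurableT_comp => //; exact: measurable_funB.
  have F0 u : (0 <= F u)%E by rewrite lee_fin mulr_ge0// normal_pdf_ge0.
  have -> : normal_prob 0 s (xsection D x) = (\int[mu]_y F ((x + y) / 2)%R)%E.
    rewrite /normal_prob integral_mkcond; apply: eq_integral => y _.
    rewrite patchE /F mem_xsection indicE.
    have -> : ((x, y) \in D) = ((x + y) / 2 \in B).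
      by apply/idP/idP; rewrite !inE.
    case: ifP => _; last by rewrite mul0r.
    by rewrite mul1r; congr (normal_pdf _ _ _)%:E; field.
  rewrite integral_average// muleAC -EFinM -ge0_integralZl//; last first.
    by rewrite lee_fin mulr_ge0 ?normal_pdf_ge0.
  by apply: eq_integral => u _; rewrite /F /g -EFinM; congr EFin; ring.
have mg : measurable_fun setT (fun z : measurableTypeR R * measurableTypeR R => (g z.1 z.2)%:E).
  apply/measurable_EFinP; apply: measurable_funM.
    exact: measurableT_comp.
  apply: measurable_funM => //; apply: measurable_funM.
    exact: measurableT_comp.
  apply: measurableT_comp => //; apply: measurable_funB => //.
  exact: measurable_funM.
have g0 x u : (0 <= (g x u)%:E)%E.
  by rewrite lee_fin !mulr_ge0// normal_pdf_ge0.
transitivity (\int[mu]_u \int[mu]_x (g x u)%:E)%E.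
  exact: (@fubini_tonelli _ _ _ _ _ mu mu _ mg (fun z => g0 z.1 z.2)).
rewrite /normal_prob [RHS]integral_mkcond.
apply: eq_integral => u _.
have -> : (\int[mu]_x (g x u)%:E = \int[mu]_x
    ((\1_B u * normal_pdf 0 (s / Num.sqrt 2) u)%:E *
     (normal_pdf u (s / Num.sqrt 2) x)%:E))%E.
  by apply: eq_integral => x _; rewrite /g normal_pdfM_average// -EFinM mulrA.
rewrite ge0_integralZl//; last 3 first.
- by apply/measurable_EFinP; exact: measurable_normal_pdf.
- by move=> x _; rewrite lee_fin normal_pdf_ge0.
- by rewrite lee_fin mulr_ge0// normal_pdf_ge0.
rewrite integral_normal_pdf mule1 patchE indicE.
by case: ifP => _; rewrite ?mul1r ?mul0r.
Qed.

End GaussianAverage.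

(** * Joint laws *)

Section Independence.
Context {R : realType} {d d' : measure_display} {T : measurableType d}
  {U : measurableType d'}.
Variable P : probability T R.

(** Intended for rectangles as [G]: independence gives the law of pairs of increments on rectangles,
    whereas a condition on the average of a pair is not a rectangle. *)
Lemma joint_law_of_pi_system (I : finType) (Z : I -> T -> U)
    (law : I -> {measure set U -> \bar R}) (G : set (set U)) :
  (forall i, measurable_fun setT (Z i)) -> (forall i, law i setT = 1%E) ->
  measurable = <<s G>> -> setI_closed G -> G setT ->
  (forall D : I -> set U, (forall i, G (D i)) ->
     P (\bigcap_i Z i @^-1` D i) = (\prod_i law i (D i))%E) ->
  forall D : I -> set U, (forall i, measurable (D i)) ->
    P (\bigcap_i Z i @^-1` D i) = (\prod_i law i (D i))%E.
Proof.
move=> mZ lawT mG GI GT PG.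
have Gm E : G E -> measurable E by move=> GE; rewrite mG; exact: sub_sigma_algebra.
(* The coordinates are freed one at a time from the pi-system [G]; each step
   compares two finite measures that agree on [G]. *)
suff H (s : seq I) (D : I -> set U) : (forall i, i \in s -> measurable (D i)) ->
    (forall i, i \notin s -> G (D i)) ->
    P (\bigcap_i Z i @^-1` D i) = (\prod_i law i (D i))%E.
  move=> D mD; apply: (H (enum I)) => i; first by move=> _; exact: mD.
  by rewrite mem_enum.
elim: s D => [|a s IH] D mD GD; first by apply: PG => i; exact: GD.
have mDi i : measurable (D i).
  by have [/mD//|/GD/Gm] := boolP (i \in a :: s).
have mZD i : measurable (Z i @^-1` D i).
  by rewrite -[X in measurable X]setTI; exact: mZ.
pose A := \bigcap_(i in [set i | i != a]) Z i @^-1` D i.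
have mA : measurable A by apply: fin_bigcap_measurable => [|i _]; [exact: finite_finset|exact: mZD].
pose c := (\prod_(i | i != a) law i (D i))%E.
have c_fin : c \is a fin_num.
  rewrite /c; elim/big_ind : _ => // [x y fx fy|i _]; first exact: fin_numM.
  rewrite ge0_fin_numE ?measure_ge0// (le_lt_trans _ (ltry 1))// -(lawT i).
  by apply: le_measure; rewrite ?inE.
have c_ge0 : 0 <= fine c.
  by apply/fine_ge0/prode_ge0 => i _; exact: measure_ge0.
pose upd E i := if i == a then E else D i.
have capE E : \bigcap_i Z i @^-1` upd E i = Z a @^-1` E `&` A.
  apply/seteqP; split=> [w h|w [ha hA] i _].
    split=> [|i /= /negPf ia]; first by have := h a Logic.I; rewrite /upd eqxx.
    by have := h i Logic.I; rewrite /upd ia.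
  by rewrite /upd; case: eqVneq => [->//|ia]; exact: hA.
have prodE E : (\prod_i law i (upd E i) = (fine c)%:E * law a E)%E.
  rewrite (bigD1 a)//= fineK// [RHS]muleC {1}/upd eqxx; congr (_ * _)%E.
  by apply: eq_bigr => i /negPf ia; rewrite /upd ia.
(* As functions of the set at coordinate [a], both sides are measures: [m1] is the law of [Z a] on
   the event [A] about the other coordinates, [m2] is [law a] scaled by the product [c] of the
   others. *)
pose m1 : {measure set U -> \bar R} :=
  measure_function_pushforward__canonical__measure_function_Measure
    (mrestr P mA) (mZ a).
pose m2 : {measure set U -> \bar R} := mscale (NngNum c_ge0) (law a).
have updD : upd (D a) = D by apply/funext => i; rewrite /upd; case: eqVneq => [->|].
rewrite -updD capE prodE.
apply: (@measure_unique _ _ _ G (fun=> setT) mG GI _ _ m1 m2) => //.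
- by rewrite bigcup_const//; exists 0%N.
- move=> E GE; rewrite /m1 /m2 /= /pushforward /mrestr /mscale /= -capE -prodE.
  apply: IH => i; rewrite /upd; case: eqVneq => [_ _|ia ias]; first exact: Gm.
  + exact: mDi.
  + exact: GE.
  + by apply: GD; rewrite inE negb_or ia.
- move=> _; rewrite /m1 /= /pushforward /mrestr preimage_setT setTI.
  by rewrite (le_lt_trans (probability_le1 P mA))// ltry.
Qed.

End Independence.

(** * Folding a matrix onto its upper triangle *)

Definition upper_index (n : nat) : finType :=
  {ij : 'I_n * 'I_n | (ij.1 <= ij.2)%N}.

(** Transposition carries the strictly lower triangle onto the strictly upper one. The operation is
    left general to serve both products of probabilities and sums of squares. *)
Lemma big_upper_index (V : Type) (idx : V) (op : Monoid.com_law idx) (n : nat)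
    (F : 'I_n * 'I_n -> V) :
  \big[op/idx]_ij F ij =
  \big[op/idx]_(a : upper_index n)
    (if (val a).1 == (val a).2 then F (val a)
     else op (F (val a)) (F ((val a).2, (val a).1))).
Proof.
rewrite -(big_sub [pred ij : 'I_n * 'I_n | (ij.1 <= ij.2)%N] (fun ij =>
  if ij.1 == ij.2 then F ij else op (F ij) (F (ij.2, ij.1)))) /=.
pose swap (ij : 'I_n * 'I_n) := (ij.2, ij.1).
have swapK : involutive swap by case.
rewrite (bigID [pred ij : 'I_n * 'I_n | (ij.1 <= ij.2)%N])/=.
rewrite [X in op _ X](reindex_inj (inv_inj swapK))/=.
rewrite [X in op _ X](eq_bigl
    (fun ij : 'I_n * 'I_n => (ij.1 <= ij.2)%N && (ij.1 != ij.2))); last first.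
  by move=> ij; rewrite -ltnNge ltn_neqAle andbC.
rewrite big_mkcondr -big_split; apply: eq_bigr => ij _ /=.
by case: eqVneq => _ /=; rewrite ?Monoid.mulm1.
Qed.

(** * Increments of a Brownian matrix and of its symmetric part *)

Section BrownianIncrements.
Context {R : realType} {d : measure_display} {Omega : measurableType d}.
Variable P : probability Omega R.

(** With the sigma-algebra of [X] as measurable structure on [Omega], each [X u] with [0 <= u] is
    measurable by construction, and so are differences. *)
Lemma process_sigma_algebra_increment (X : R -> Omega -> R) (s t : R)
    (B : set R) :
  0 <= s -> 0 <= t -> measurable B ->
  process_sigma_algebra X [set w | B (X t w - X s w)].
Proof.
move=> s0 t0 mB.
pose G := [set E | exists t B, [/\ 0 <= t, measurable B & E = X t @^-1` B]].
have mX u : 0 <= u -> measurable_fun setT (X u : g_sigma_algebraType G -> R).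
  move=> u0 _ C mC; rewrite setTI; apply: sub_sigma_algebra.
  by exists u, C.
have := measurable_funB (mX t t0) (mX s s0) measurableT mB.
by rewrite setTI.
Qed.

(** Events are grouped by entry: independence of the processes splits the entries, then independence
    of increments splits the steps of each entry. *)
Lemma brownian_matrix_increments (n m : nat) (sigma : R)
    (M : R -> Omega -> 'M[R]_n)
    (C : 'I_m * ('I_n * 'I_n) -> set R) :
  brownian_matrix P sigma M -> (forall a, measurable (C a)) ->
  P (\bigcap_a [set w | C a
       (M a.1.+2%:R w a.2.1 a.2.2 - M a.1.+1%:R w a.2.1 a.2.2)])
  = (\prod_a normal_prob 0 sigma (C a))%E.
Proof.
move=> [bm ind] mC.
pose A (ij : 'I_n * 'I_n) := \bigcap_k
  [set w | C (k, ij) (M k.+2%:R w ij.1 ij.2 - M k.+1%:R w ij.1 ij.2)].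
have -> : \bigcap_a [set w | C a (M a.1.+2%:R w a.2.1 a.2.2 -
    M a.1.+1%:R w a.2.1 a.2.2)] = \bigcap_ij A ij.
  apply/seteqP; split=> [w h ij _ k _|w h [k ij] _]; first exact: (h (k, ij)).
  exact: (h ij _ k).
rewrite ind; last first.
  move=> ij; rewrite /process_sigma_algebra.
  pose G := [set E | exists t B, [/\ 0 <= t, measurable B &
    E = (fun w => M t w ij.1 ij.2) @^-1` B]].
  apply: (@fin_bigcap_measurable _ (g_sigma_algebraType G)) => [|k _].
    exact: finite_finset.
  exact: process_sigma_algebra_increment.
rewrite (eq_bigr (fun ij => \prod_k normal_prob 0 sigma (C (k, ij)))%E); last first.
  move=> [i j] _; have := bm_independent (bm i j).
  move=> /(_ m (fun k => k.+1%:R) (fun k => C (k, (i, j)))) /=.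
  rewrite /A /= => ->//; last by move=> k; rewrite ler_nat.
  apply: eq_bigr => k _.
  (* Each step has length [1], hence standard deviation [sigma * Num.sqrt 1]. *)
  have -> : normal_prob 0 sigma = normal_prob 0 (sigma * Num.sqrt 1) by rewrite sqrtr1 mulr1.
  rewrite -(bm_gaussian (bm i j) (ler0n R k.+1) ltr01 (mC _)).
  by rewrite natr1.
by rewrite exchange_big pair_bigA; apply: eq_bigr => -[].
Qed.

(* The law of the increments of the entries (i, j) and (j, i), which coincide when
   i = j. *)
Definition pair_law (n : nat) (sigma : R) (a : upper_index n) :
    {measure set (measurableTypeR R * measurableTypeR R) -> \bar R} :=
  if (val a).1 == (val a).2 then
    measure_function_pushforward__canonical__measure_function_Measure
      (normal_prob 0 sigma)
      (measurable_fun_pair (@measurable_id _ (measurableTypeR R) setT)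
        (@measurable_id _ (measurableTypeR R) setT))
  else (normal_prob 0 sigma \x normal_prob 0 sigma)%E.

Lemma pair_law_setX (n : nat) (sigma : R) (a : upper_index n) (C C' : set R) :
  measurable C -> measurable C' ->
  pair_law sigma a (C `*` C') =
    if (val a).1 == (val a).2 then normal_prob 0 sigma (C `&` C')
    else (normal_prob 0 sigma C * normal_prob 0 sigma C')%E.
Proof.
move=> mC mC'; rewrite /pair_law; case: ifP => // _.
by rewrite /= product_measure1E.
Qed.

Definition sym_sd (n : nat) (sigma : R) (a : upper_index n) : R :=
  if (val a).1 == (val a).2 then sigma else sigma / Num.sqrt 2.

Lemma pair_law_average (n : nat) (sigma : R) (a : upper_index n) (B : set R) :
  sigma != 0 -> measurable B ->
  pair_law sigma a [set z | B ((z.1 + z.2) / 2)] =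
  normal_prob 0 (sym_sd sigma a) B.
Proof.
move=> s0 mB; rewrite /pair_law /sym_sd; case: ifP => _.
  rewrite /= /pushforward; congr (normal_prob _ _ _).
  by apply/funext => x /=; congr (B _); field.
by rewrite /= normal_prob_average.
Qed.

(** Pairing an entry with its transpose cuts the increments into mutually independent blocks, each
    of which determines one free entry of the symmetric part. *)
Definition transposed_increments (n m : nat) (M : R -> Omega -> 'M[R]_n)
    (a : 'I_m * upper_index n) (w : Omega) :
    measurableTypeR R * measurableTypeR R :=
  let i := (val a.2).1 in let j := (val a.2).2 in
  (M a.1.+2%:R w i j - M a.1.+1%:R w i j,
   M a.1.+2%:R w j i - M a.1.+1%:R w j i).

(** On rectangles, the conditions on pairs amount to one condition [F b] for each single entry [b].
    The law of the entries then applies, and its product is regrouped by transposed pairs. *)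
Lemma transposed_increments_law (n m : nat) (sigma : R)
    (M : R -> Omega -> 'M[R]_n) (D : 'I_m * upper_index n ->
      set (measurableTypeR R * measurableTypeR R)) :
  brownian_matrix P sigma M -> (forall a, measurable (D a)) ->
  P (\bigcap_a transposed_increments M a @^-1` D a) =
  (\prod_a pair_law sigma a.2 (D a))%E.
Proof.
move=> bm; move: D.
apply: (joint_law_of_pi_system (law := fun a => pair_law sigma a.2)
  (G := [set A `*` B | A in measurable & B in measurable])).
- move=> [k [[i j] ij]]; rewrite /transposed_increments /=.
  apply: measurable_fun_pair; apply: measurable_funB.
  + exact: (bm_measurable (bm.1 i j)).
  + exact: (bm_measurable (bm.1 i j)).
  + exact: (bm_measurable (bm.1 j i)).
  + exact: (bm_measurable (bm.1 j i)).
- move=> a; rewrite -setXTT pair_law_setX// setTI.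
  by case: ifP => _; rewrite !probability_setT ?mule1.
- exact: measurable_prod_measurableType.
- move=> _ _ [A mA [B mB <-]] [A' mA' [B' mB' <-]]; rewrite -setXI.
  exists (A `&` A'); first exact: measurableI.
  by exists (B `&` B'); first exact: measurableI.
- by exists setT => //; exists setT => //; rewrite setXTT.
move=> D GD.
have /choice[C CP] a : exists c : set (measurableTypeR R) * set (measurableTypeR R),
    [/\ measurable c.1, measurable c.2 & D a = c.1 `*` c.2].
  by have [A mA [B mB <-]] := GD a; exists (A, B).
(* For b on or above the diagonal (resp. below), only the first (resp. second)
   intersection is over a nonempty family; on the diagonal, both are. *)
pose F (b : 'I_m * ('I_n * 'I_n)) : set (measurableTypeR R) :=
  \bigcap_(a in [set a | (a.1, val a.2) = b]) (C a).1 `&`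
  \bigcap_(a in [set a | (a.1, ((val a.2).2, (val a.2).1)) = b]) (C a).2.
have mF b : measurable (F b).
  by apply: measurableI; apply: fin_bigcap_measurable => [|a _];
    [exact: finite_finset|have [] := CP a|exact: finite_finset|have [] := CP a].
have FE (k : 'I_m) (a : upper_index n) : F (k, val a) =
    if (val a).1 == (val a).2 then (C (k, a)).1 `&` (C (k, a)).2 else (C (k, a)).1.
  case: eqVneq => ij.
    apply/seteqP; split=> [x [h1 h2]|x [h1 h2]].
      split; first exact: (h1 (k, a)).
      by apply: (h2 (k, a)); rewrite /= [in RHS](surjective_pairing (\val a)) ij.
    split=> -[k' a'] /= [-> e]; first by have -> : a' = a by exact/val_inj.
    suff -> : a' = a by [].
    apply/val_inj; rewrite /= -e in ij *.
    by case: (val a') ij => ? ? /= ->.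
  apply/seteqP; split=> [x [h1 _]|x h]; first exact: (h1 (k, a)).
  split=> -[k' a'] /= [-> e]; first by have -> : a' = a by exact/val_inj.
  (* An upper index whose transpose is also an upper index is diagonal, so the second intersection
     in [F] is empty here. *)
  have := valP a; have := valP a'; rewrite /= -e in ij *; rewrite /= => le1 le2.
  by case/eqP: ij; apply/val_inj/eqP; rewrite eqn_leq le1 le2.
have FsE (k : 'I_m) (a : upper_index n) : (val a).1 != (val a).2 ->
    F (k, ((val a).2, (val a).1)) = (C (k, a)).2.
  move=> ij; apply/seteqP; split=> [x [_ h2]|x h]; first exact: (h2 (k, a)).
  split=> -[k' a'] /=; last first.
    move=> [-> e2 e1]; suff -> : a' = a by [].
    by apply/val_inj; rewrite /= [LHS]surjective_pairing e1 e2 -surjective_pairing.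
  move=> [-> e]; have := valP a; have := valP a'; rewrite /= e /= => le1 le2.
  by case/eqP: ij; apply/val_inj/eqP; rewrite eqn_leq le1 le2.
have -> : \bigcap_a transposed_increments M a @^-1` D a = \bigcap_b
    [set w | F b (M b.1.+2%:R w b.2.1 b.2.2 - M b.1.+1%:R w b.2.1 b.2.2)].
  apply/seteqP; split=> [w h b _|w h a _].
    by split=> a /= <-; have [_ _ Da] := CP a; have := h a Logic.I; rewrite /= Da => -[].
  have [_ _ Da] := CP a; rewrite /= Da; split.
    by have [h1 _] := h (a.1, val a.2) Logic.I; exact: h1.
  by have [_ h2] := h (a.1, ((val a.2).2, (val a.2).1)) Logic.I; exact: h2.
rewrite (brownian_matrix_increments bm mF).
transitivity (\prod_k \prod_ij normal_prob 0 sigma (F (k, ij)))%E.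
  by rewrite pair_bigA; apply: eq_bigr => -[].
transitivity (\prod_k \prod_a pair_law sigma a (D (k, a)))%E; last first.
  by rewrite pair_bigA; apply: eq_bigr => -[].
apply: eq_bigr => k _; rewrite big_upper_index; apply: eq_bigr => a _.
have [mC1 mC2 ->] := CP (k, a); rewrite pair_law_setX// FE.
by case: eqVneq => // ij; rewrite FsE.
Qed.

End BrownianIncrements.

(** * The likelihood *)

Section Likelihood.
Context {R : realType} {n T : nat}.
Local Notation index := (@increment_index n T).

Definition gaussian_density (sigma : R) (v : 'rV[R]_#|index|) : R :=
  \prod_(m < #|index|)
    normal_pdf 0 (sym_sd sigma ((enum_val m : index).2 : upper_index n)) (v 0 m).

(** The normalizing constant of the density; it does not depend on the candidate covariance. *)
Definition gaussian_peak (sigma : R) : R :=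
  \prod_(m < #|index|)
    normal_peak (sym_sd sigma ((enum_val m : index).2 : upper_index n)).

Lemma sym_sd_neq0 (sigma : R) (a : upper_index n) :
  sigma != 0 -> sym_sd sigma a != 0.
Proof.
move=> s0; rewrite /sym_sd; case: ifP => // _.
by rewrite mulf_neq0// invr_neq0// gt_eqF// sqrtr_gt0.
Qed.

Lemma gaussian_peak_gt0 (sigma : R) : sigma != 0 -> 0 < gaussian_peak sigma.
Proof.
by move=> s0; apply: prodr_gt0 => m _; exact/normal_peak_gt0/sym_sd_neq0.
Qed.

Lemma continuous_gaussian_density (sigma : R) : sigma != 0 ->
  continuous (gaussian_density sigma).
Proof.
move=> s0; rewrite /gaussian_density => v.
apply: (@cvg_big R _ *%R 1 predT (@mul_continuous R)) => [|m _].
  exact: nbhs_filter.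
apply: (cvg_comp (fun v : 'rV_#|index| => v 0 m) (normal_pdf 0 _)).
  exact: coord_continuous.
exact/continuous_normal_pdf/sym_sd_neq0.
Qed.

Lemma symmetric_incrementsE (N : nat -> 'M[R]_n) (m : 'I_#|index|) :
  symmetric_increments T N 0 m =
  let: (k, a) := (enum_val m : index) in
  (symmetric_part (N k.+2) - symmetric_part (N k.+1)) (val a).1 (val a).2.
Proof. by rewrite mxE; case: (enum_val m). Qed.

Lemma frobenius_norm_sqr (A : 'M[R]_n) :
  frobenius_norm A ^+ 2 = \sum_ij A ij.1 ij.2 ^+ 2.
Proof.
rewrite sqr_sqrtr; first by rewrite pair_bigA.
by apply: sumr_ge0 => i _; apply: sumr_ge0 => j _; exact: sqr_ge0.
Qed.

Lemma gaussian_density_increments (sigma : R) (N : nat -> 'M[R]_n) :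
  sigma != 0 ->
  gaussian_density sigma (symmetric_increments T N) =
  gaussian_peak sigma *
  expR (- (\sum_(1 <= t < T)
    frobenius_norm (symmetric_part (N t.+1) - symmetric_part (N t)) ^+ 2)
    / (2 * sigma ^+ 2)).
Proof.
move=> s0; pose D (k : nat) := symmetric_part (N k.+2) - symmetric_part (N k.+1).
have symD k i j : D k i j = D k j i.
  by rewrite /D /symmetric_part !mxE [N k.+2 i j + _]addrC [N k.+1 i j + _]addrC.
have -> : \sum_(1 <= t < T)
    frobenius_norm (symmetric_part (N t.+1) - symmetric_part (N t)) ^+ 2 =
    \sum_(k < T.-1) frobenius_norm (D k) ^+ 2.
  by rewrite big_add1 big_mkord.
pose e (a : 'I_T.-1 * upper_index n) :=
  - D a.1 (val a.2).1 (val a.2).2 ^+ 2 / (sym_sd sigma a.2 ^+ 2 *+ 2).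
rewrite /gaussian_density (eq_bigr (fun m : 'I_#|index| =>
  normal_peak (sym_sd sigma ((enum_val m : index).2 : upper_index n)) *
    expR (e (enum_val m)))); last first.
  move=> m _; rewrite normal_pdfE ?sym_sd_neq0// symmetric_incrementsE /e /normal_fun.
  by case: (enum_val m) => k a /=; rewrite subr0.
rewrite big_split /= -expR_sum -/(gaussian_peak sigma); congr (_ * expR _).
rewrite -(big_enum_val e) /=.
transitivity (\sum_k \sum_a e (k, a)).
  by rewrite pair_bigA; apply: eq_bigr => -[].
rewrite -sumrN mulr_suml; apply: eq_bigr => k _.
rewrite frobenius_norm_sqr big_upper_index -sumrN mulr_suml; apply: eq_bigr => a _.
rewrite /e /sym_sd /=; case: ifP => _.
  by rewrite mulr_natl.
(* Off the diagonal the variance is [sigma ^+ 2 / 2], so one factor of the density accounts for the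
   two equal squares at [(i, j)] and [(j, i)]. *)
rewrite [D k (val a).2 _]symD exprMn exprVn sqr_sqrtr//.
by field.
Qed.

(** Both functions have the same integral over every box, by the law of the transposed pairs and of
    their averages; continuity turns this into equality at every point. *)
Lemma continuous_density_gaussian {d : measure_display}
    {Omega : measurableType d} (P : probability Omega R) (sigma : R) (M : R -> Omega -> 'M[R]_n)
    (p : 'rV[R]_#|index| -> R) :
  sigma != 0 -> brownian_matrix P sigma M ->
  continuous_density P
    (fun w => symmetric_increments T (fun t => M t%:R w)) p ->
  p = gaussian_density sigma.
Proof.
move=> s0 bm [cp p0 pB].
have g0 v : 0 <= gaussian_density sigma v.
  by apply: prodr_ge0 => m _; exact: normal_pdf_ge0.
have eqB (B : 'I_#|index| -> set R) : (forall k, measurable (B k)) ->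
    box_integral B p = box_integral B (gaussian_density sigma).
  move=> mB; rewrite -pB//.
  have -> : [set w | forall m, B m (symmetric_increments T (fun t => M t%:R w) 0 m)] =
      \bigcap_(a : index) transposed_increments M (a : 'I_T.-1 * upper_index n) @^-1`
        [set z | B (enum_rank a) ((z.1 + z.2) / 2)].
    have inc w a : symmetric_increments T (fun t => M t%:R w) 0 (enum_rank a) =
        ((transposed_increments M (a : 'I_T.-1 * upper_index n) w).1 +
         (transposed_increments M (a : 'I_T.-1 * upper_index n) w).2) / 2.
      rewrite symmetric_incrementsE enum_rankK; case: a => k a.
      by rewrite /symmetric_part !mxE /=; field.
    apply/seteqP; split=> w h; first by move=> a _; rewrite /= -inc.
    by move=> m; have := h (enum_val m) Logic.I; rewrite /= -inc enum_valK.
  rewrite (transposed_increments_law bm); last first.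
    move=> a.
    have mavg : measurable_fun setT
        (fun z : measurableTypeR R * measurableTypeR R => (z.1 + z.2) / 2).
      by apply: measurable_funM => //; exact: measurable_funD.
    by rewrite -[X in measurable X]setTI; exact: mavg.
  rewrite [X in box_integral _ X](_ : _ = fun v => 1 * gaussian_density sigma v); last first.
    by apply/funext => v; rewrite mul1r.
  pose f (m : 'I_#|index|) :=
    normal_pdf 0 (sym_sd sigma ((enum_val m : index).2 : upper_index n)).
  rewrite (@box_integral_prod _ _ B f 1)//; last 2 first.
    by move=> k; exact: measurable_normal_pdf.
    by move=> k x; exact: normal_pdf_ge0.
  rewrite mul1e.
  pose q (a : index) := normal_prob 0 (sym_sd sigma (a.2 : upper_index n)) (B (enum_rank a)).
  rewrite (eq_bigr q); last by move=> a _; rewrite pair_law_average.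
  rewrite (big_enum_val q); apply: eq_bigr => m _.
  by rewrite /q enum_valK.
have cg := continuous_gaussian_density s0.
apply/funext => v; apply/le_anti/andP; split.
  exact: le_continuous_box_integral.
by apply: le_continuous_box_integral => // B mB; rewrite eqB.
Qed.

(** The beliefs behind [W] are not unique, but the density sees only their symmetric part, which [S]
    and [W] fix. The beliefs [2 *: (S *m W t)] show that a value exists. *)
Lemma likelihood_gaussian (sigma : R) (W : nat -> 'M[R]_n) (S : 'M[R]_n)
    (l : R) :
  sigma != 0 -> psd S -> (forall t, (1 <= t <= T)%N -> W t = (W t)^T) ->
  likelihood (gaussian_density sigma) W S l <->
  l = gaussian_peak sigma *
    expR (- sdp_objective T W S / (2 * sigma ^+ 2)).
Proof.
move=> s0 pS symW.
suff H (N : nat -> 'M[R]_n) :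
    (forall t, (1 <= t <= T)%N -> homogeneous_network S (N t) (W t)) ->
    gaussian_density sigma (symmetric_increments T N) =
    gaussian_peak sigma *
    expR (- sdp_objective T W S / (2 * sigma ^+ 2)).
  split=> [[N [hN ->]]|->]; first exact: H.
  exists (fun t => 2 *: (S *m W t)).
  have hN t : (1 <= t <= T)%N -> homogeneous_network S (2 *: (S *m W t)) (W t).
    by move=> /symW; exact: homogeneous_network_of_sym.
  by split=> //; rewrite H.
move=> hN; rewrite gaussian_density_increments//.
suff -> : \sum_(1 <= t < T) frobenius_norm
    (symmetric_part (N t.+1) - symmetric_part (N t)) ^+ 2 = sdp_objective T W S by [].
rewrite /sdp_objective; apply: eq_big_nat => t /andP[t1 tT].
have sS := pS.1.
rewrite (homogeneous_network_sym sS (hN t _)) ?t1 ?(ltnW tT)//.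
rewrite (homogeneous_network_sym sS (hN t.+1 _)) ?tT//.
by rewrite mulmxBr mulmxBl opprD addrACA.
Qed.

(** The objective is a sum of squares of linear functions of [S], hence convex. *)
Lemma sdp_objective_midpoint (W : nat -> 'M[R]_n) (S S' : 'M[R]_n) :
  sdp_objective T W (2^-1 *: (S + S')) <=
  2^-1 * (sdp_objective T W S + sdp_objective T W S').
Proof.
rewrite /sdp_objective -big_split /= mulr_sumr; apply: ler_sum => t _.
rewrite !frobenius_norm_sqr -big_split /= mulr_sumr; apply: ler_sum => ij _.
set D := W t.+1 - W t.
have -> : (2^-1 *: (S + S')) *m D + D *m (2^-1 *: (S + S')) =
    2^-1 *: ((S *m D + D *m S) + (S' *m D + D *m S')).
  by rewrite -scalemxAl -scalemxAr -scalerDr mulmxDl (mulmxDr D) addrACA.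
move: (S *m D + _) (S' *m D + _) => X Y; rewrite !mxE.
move: (X _ _) (Y _ _) => x y; rewrite -subr_ge0.
suff -> : 2^-1 * (x ^+ 2 + y ^+ 2) - (2^-1 * (x + y)) ^+ 2 = (2^-1 * (x - y)) ^+ 2.
  exact: sqr_ge0.
by field.
Qed.

End Likelihood.

(** * Maximum likelihood and the semidefinite program *)

Lemma posdef_midpoint {R : realType} {n : nat} (S S' : 'M[R]_n) :
  posdef S -> psd S' -> posdef (2^-1 *: (S + S')).
Proof.
move=> [sS pS] [sS' pS']; split; first by rewrite linearZ linearD /= sS sS'.
move=> x x0; rewrite -scalemxAr -scalemxAl mxE mulmxDr mulmxDl mxE.
by rewrite mulr_gt0// ltr_pwDl// pS.
Qed.

Theorem proposition1 (R : realType) (d : measure_display)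
    (Omega : measurableType d) (P : probability Omega R) (n T : nat)
    (sigma : R) (M : R -> Omega -> 'M[R]_n) (Sigma0 : 'M[R]_n)
    (omega : Omega) (W : nat -> 'M[R]_n)
    (p : 'rV[R]_#|@increment_index n T| -> R)
    (hsigma : 0 < sigma)
    (hM : brownian_matrix P sigma M)
    (hSigma0 : posdef Sigma0)
    (htr : \tr Sigma0 = 1)
    (hW : forall t, (1 <= t <= T)%N ->
       homogeneous_network Sigma0 (M t%:R omega) (W t))
    (hp : continuous_density P
       (fun w => symmetric_increments T (fun t => M t%:R w)) p) :
  (forall Sigma : 'M[R]_n,
     maximum_likelihood_estimator [set S | psd S /\ \tr S = 1] p W Sigma
       <-> sdp_solution T W Sigma) /\
  (forall Sigma : 'M[R]_n,
     maximum_likelihood_estimator [set S | posdef S /\ \tr S = 1] p W Sigma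
       <-> posdef Sigma /\ sdp_solution T W Sigma).
Proof.
have s0 : sigma != 0 by rewrite gt_eqF.
have symW t : (1 <= t <= T)%N -> W t = (W t)^T by move=> /hW[Q [[]]].
rewrite (continuous_density_gaussian s0 hM hp).
(* For any parameter set of semidefinite matrices, the likelihood is a strictly decreasing function
   of the objective; both equivalences start from this. *)
have mle (Theta : set 'M[R]_n) S : (forall S', Theta S' -> psd S') ->
    maximum_likelihood_estimator Theta (@gaussian_density R n T sigma) W S <->
    Theta S /\ forall S', Theta S' -> sdp_objective T W S <= sdp_objective T W S'.
  move=> Tpsd.
  have c0 : 0 < @gaussian_peak R n T sigma by exact: gaussian_peak_gt0.
  have le_obj S1 S2 :
      (@gaussian_peak R n T sigma * expR (- sdp_objective T W S1 / (2 * sigma ^+ 2)) <=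
       @gaussian_peak R n T sigma * expR (- sdp_objective T W S2 / (2 * sigma ^+ 2))) =
      (sdp_objective T W S2 <= sdp_objective T W S1).
    rewrite (ler_pM2l c0) ler_expR ler_pM2r ?lerN2//.
    by rewrite invr_gt0 mulr_gt0// exprn_gt0.
  split=> [[TS [l [lS opt]]]|[TS opt]]; split=> //.
    move=> S' TS'.
    move: lS opt => /(likelihood_gaussian _ s0 (Tpsd _ TS) symW) -> opt.
    rewrite -le_obj; apply: (opt S') => //.
    exact/(likelihood_gaussian _ s0 (Tpsd _ TS') symW).
  exists (@gaussian_peak R n T sigma *
    expR (- sdp_objective T W S / (2 * sigma ^+ 2))).
  split; first exact/(likelihood_gaussian _ s0 (Tpsd _ TS) symW).
  move=> S' l' TS' /(likelihood_gaussian _ s0 (Tpsd _ TS') symW) ->.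
  by rewrite le_obj; exact: opt.
split=> S; first by rewrite mle// => S' [].
rewrite mle => [|S' [/posdef_psd//]]; split.
  move=> [[pS trS] opt]; split=> //; split; first by split=> //; exact: posdef_psd.
  (* [S'] may be singular, but its midpoint with [S] is an admissible competitor. Writing [f] for
     the objective, [f S <= f mid <= (f S + f S') / 2] gives [f S <= f S']. *)
  move=> S' [psdS' trS'].
  have := @sdp_objective_midpoint R n T W S S'.
  suff : sdp_objective T W S <= sdp_objective T W (2^-1 *: (S + S')) by lra.
  apply: opt; split; first exact: posdef_midpoint.
  by rewrite linearZ linearD /= trS trS' mulVf// pnatr_eq0.
move=> [pS [[_ trS] opt]]; split=> // S' [pS' trS'].
by apply: opt; split=> //; exact: posdef_psd.
Qed.
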